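(* Let $n$ be a positive integer and let $\Omega_1,\Omega_2$ be two distinct copies of $2^{[n]}$, where $[n]=\{1,\dots,n\}$. For $i=1,2$ let $\bm{p}_i=(p_i^{(1)},\dots,p_i^{(n)})$ be a probability vector (i.e. $0<p_i^{(\ell)}<1$ for all $\ell$), write $p_i:=p_i^{(1)}$, and let $\mu_i$ be the product measure on $\Omega_i$ given by $$\mu_i(U)=\sum_{x\in U}\prod_{\ell\in x}p_i^{(\ell)}\prod_{k\in[n]\setminus x}(1-p_i^{(k)})\qquad (U\subset\Omega_i).$$ Assume that $p_i=\max\{p_i^{(\ell)}:\ell\in[n]\}$ for $i=1,2$, and that $p_1^{(\ell)},p_2^{(\ell)}\leqslant 1/2$ for all $\ell\geqslant 2$. If $U_1\subset\Omega_1$ and $U_2\subset\Omega_2$ are cross-intersecting (i.e. $x\cap y\neq\emptyset$ for all $x\in U_1$, $y\in U_2$), then $$\mu_1(U_1)\mu_2(U_2)\leqslant p_1p_2.$$ Moreover, let $w:=\{\ell\in[n]:(p_1^{(\ell)},p_2^{(\ell)})=(p_1,p_2)\}$ and, for $i=1,2$ and $\ell\in[n]$, let $U_i^{(\ell)}:=\{x\in\Omega_i:\ell\in x\}$. Unless $p_1=p_2=1/2$ and $|w|\geqslant 3$, equality holds if and only if $U_1=U_1^{(\ell)}$ and $U_2=U_2^{(\ell)}$ for some $\ell\in w$.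
   Context: A probability vector is a vector $\bm{p}=(p^{(1)},\dots,p^{(n)})$ with $0<p^{(\ell)}<1$ for every $\ell$. *)

(* Defs.v *)
(* ground set [n] = 'I_n (element 1 of the paper is the
   ordinal 0), Omega = {set 'I_n}, probabilities in a realType R. *)
From HB Require Import structures.
From mathcomp Require Import all_boot all_order all_algebra.
From mathcomp Require Import reals.
Set Implicit Arguments. Unset Strict Implicit. Unset Printing Implicit Defensive.
Import Order.TTheory GRing.Theory Num.Theory.
Local Open Scope ring_scope.

Definition prob_vector (R : realType) (n : nat) (p : 'I_n -> R) : Prop :=
  forall l, 0 < p l < 1.

Definition pmeasure (R : realType) (n : nat) (p : 'I_n -> R)
  (U : {set {set 'I_n}}) : R :=
  \sum_(x in U) ((\prod_(l in x) p l) * (\prod_(k in ~: x) (1 - p k))).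

Definition cross_intersecting (n : nat) (U1 U2 : {set {set 'I_n}}) : Prop :=
  forall x y, x \in U1 -> y \in U2 -> x :&: y != set0.

Definition star (n : nat) (l : 'I_n) : {set {set 'I_n}} := [set x : {set 'I_n} | l \in x].

(* Main.v *)
Require Import Defs.
From HB Require Import structures.
From mathcomp Require Import all_boot all_order all_algebra.
From mathcomp Require Import reals ring lra.
Import Order.TTheory GRing.Theory Num.Theory.
Local Open Scope ring_scope.
Set Implicit Arguments.
Unset Strict Implicit.

(** Both families may be replaced by their up-closures.  Split two upsets on a
    coordinate [l]: if [a_i <= b_i] are the measures of the sections of [U_i] at
    [l], then [mu_i(U_i) = (1 - p_i(l)) a_i + p_i(l) b_i], and [(a_1, b_2)] and
    [(b_1, a_2)] are again the measures of cross-intersecting pairs, on one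
    coordinate less.  When the probabilities are at most [c_i <= 1/2], this
    mixing preserves the set of all [(x, y)] with [x y <= c_1 c_2] and
    [x y (1 - c_1) (1 - c_2) <= c_1 c_2 (1 - x) (1 - y)], whence the bound by
    induction.  The second inequality is the Hoffman (spectral) bound; the first
    one is not preserved alone, as it says too little when [a_i] is much smaller
    than [b_i].  A top probability above [1/2] is reduced to the cap [1/2] by a
    last split at its coordinate, because
    [mu_i(U_i) / p_i = b_i + a_i (1 - p_i) / p_i] decreases with [p_i].  If
    [c_1 = c_2 = 1/2], the Hoffman bound reads [x + y <= 1], and equality forces
    the families not to depend on the coordinates outside [w]. *)

(** * Mixing inequalities *)

Section Numeric.
Variable R : realFieldType.
Implicit Types a b c q A C : R.

(* [A] and [C] stand for the odds [(1 - c_i) / c_i].  The hypotheses bound [b1]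
   by [(1 - a2) / (1 + (A C - 1) a2)] and symmetrically [b2]; after clearing
   denominators, the right-hand side minus the left-hand side dominates
   the sum of the nonnegative terms of [E1], [E2], [E3] and [E4]. *)
Lemma spread_prod_le A C a1 b1 a2 b2 :
  1 <= A -> 1 <= C -> 0 <= a1 <= b1 -> 0 <= a2 <= b2 -> b1 <= 1 -> b2 <= 1 ->
  A * C * (a1 * b2) <= (1 - a1) * (1 - b2) ->
  A * C * (b1 * a2) <= (1 - b1) * (1 - a2) ->
  A * C * a1 <= b1 -> A * C * a2 <= b2 ->
  A * C * (a1 - a2) ^+ 2 +
    (A * C - 1) ^+ 2 * (a1 * a2) * (1 - A * C * (a1 * a2))
   <= (1 + (A * C - 1) * a1) * (1 + (A * C - 1) * a2) *
      (1 - (b1 + A * a1) * (b2 + C * a2)).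
Proof.
move=> hA hC /andP[a10 ab1] /andP[a20 ab2] b11 b21 h1 h2 s1 s2.
set D1 := 1 + _ * a1; set D2 := 1 + _ * a2.
have g1 : 1 <= A * C by rewrite -[1]mulr1 ler_pM.
have gA : A <= A * C by rewrite ler_peMr// (le_trans _ hA).
have D11 : 1 <= D1 by rewrite lerDl mulr_ge0// subr_ge0.
have D21 : 1 <= D2 by rewrite lerDl mulr_ge0// subr_ge0.
have b1D : b1 * D2 <= 1 - a2 by rewrite /D2; lra.
have b2D : b2 * D1 <= 1 - a1 by rewrite /D1; lra.
have T1 : 0 <= 1 - a2 - A * C * a1 * D2.
  rewrite subr_ge0 (le_trans _ b1D)// ler_wpM2r//; lra.
have T2 : 0 <= 1 - a1 - A * C * a2 * D1.
  rewrite subr_ge0 (le_trans _ b2D)// ler_wpM2r//; lra.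
have F : (b1 * D2 + A * a1 * D2) * (b2 * D1 + C * a2 * D1) <=
   (1 - a2 + A * a1 * D2) * (1 - a1 + C * a2 * D1).
  have A0 : 0 <= A by lra.
  have C0 : 0 <= C by lra.
  have D10 : 0 <= D1 by lra.
  have D20 : 0 <= D2 by lra.
  have b10 : 0 <= b1 by lra.
  have b20 : 0 <= b2 by lra.
  by rewrite ler_pM ?lerD2r// addr_ge0 ?mulr_ge0.
have E1 : 0 <= (A - 1) * a2 * (1 - a2 - A * C * a1 * D2).
  by rewrite !mulr_ge0// subr_ge0.
have E2 : 0 <= (A * C - A) * a1 * (1 - a1 - A * C * a2 * D1).
  by rewrite !mulr_ge0// subr_ge0.
have E3 : 0 <= (A * C - 1) ^+ 2 * (a1 * a2) * ((A - 1) * a2 + (A * C - A) * a1).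
  apply: mulr_ge0; first exact: mulr_ge0 (sqr_ge0 _) (mulr_ge0 a10 a20).
  by rewrite addr_ge0// mulr_ge0// subr_ge0.
have E4 : 0 <= (A - 1) * (C - 1) * (a2 * (1 - a2) * D1).
  have ? : a2 <= 1 by lra.
  have ? : 0 <= D1 by lra.
  by rewrite mulr_ge0// mulr_ge0 ?subr_ge0// mulr_ge0 ?subr_ge0.
move: F E1 E2 E3 E4; rewrite /D1 /D2 => F E1 E2 E3 E4.
lra.
Qed.

(** For odds [A] and [C], [1 + A] is [1 / c1] and [1 + C] is [1 / c2], so the product bound on the
    larger cross product [a1 * b2] is what enters here. The identity [E] writes [b1] times the gap
    as a sum of three nonnegative terms; at equality the first gives [a1 * b2 = b1 * a2] and the
    third makes the product bound tight. *)
Lemma narrow_prod_le A C a1 b1 a2 b2 :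
  1 <= A -> 1 <= C -> 0 <= a1 <= b1 -> 0 <= a2 <= b2 ->
  (1 + A) * (1 + C) * (a1 * b2) <= 1 ->
  b1 <= A * C * a1 -> b1 * a2 <= a1 * b2 ->
  (b1 + A * a1) * (b2 + C * a2) <= 1 /\
  ((b1 + A * a1) * (b2 + C * a2) = 1 ->
   (1 + A) * (1 + C) * (a1 * b2) = 1 /\ (1 + A) * (1 + C) * (b1 * a2) = 1).
Proof.
move=> hA hC /andP[a10 ab1] /andP[a20 ab2] k1 s1 s12.
have [b10|b10] := eqVneq b1 0.
  have -> : a1 = 0 by apply/le_anti; rewrite a10 -b10 ab1.
  by rewrite b10 mulr0 addr0 mul0r; split => // /eqP; rewrite eq_sym oner_eq0.
have {}b10 : 0 < b1 by rewrite lt_def b10 (le_trans a10).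
have X0 : 0 < b1 + A * a1 by rewrite ltr_wpDr// mulr_ge0// (le_trans _ hA).
have F1 : 0 <= (b1 + A * a1) * (C * (a1 * b2 - b1 * a2)).
  by rewrite !mulr_ge0 ?subr_ge0// ?(ltW X0)//; lra.
have F2 : 0 <= b2 * ((b1 - a1) * (A * C * a1 - b1)).
  by rewrite !mulr_ge0 ?subr_ge0//; lra.
have F3 : 0 <= b1 * (1 - (1 + A) * (1 + C) * (a1 * b2)).
  by rewrite mulr_ge0 ?(ltW b10)// subr_ge0.
have E : b1 * (1 - (b1 + A * a1) * (b2 + C * a2)) =
  (b1 + A * a1) * (C * (a1 * b2 - b1 * a2)) +
  b2 * ((b1 - a1) * (A * C * a1 - b1)) +
  b1 * (1 - (1 + A) * (1 + C) * (a1 * b2)) by ring.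
split; first by rewrite -subr_ge0 -(pmulr_rge0 _ b10) E !addr_ge0.
move=> E1; move: E; rewrite E1 subrr mulr0 => E.
have G1 : (b1 + A * a1) * (C * (a1 * b2 - b1 * a2)) = 0 by lra.
have G3 : b1 * (1 - (1 + A) * (1 + C) * (a1 * b2)) = 0 by lra.
have H3 : (1 + A) * (1 + C) * (a1 * b2) = 1.
  by move/eqP: G3; rewrite mulf_eq0 (gt_eqF b10)/= subr_eq0 => /eqP.
split=> //; rewrite -[RHS]H3; congr (_ * _).
have C0 : 0 < C by lra.
move/eqP: G1; rewrite !mulf_eq0 (gt_eqF X0) (gt_eqF C0)/= subr_eq0.
by move/eqP.
Qed.

(** The factors [1 + (A C - 1) a_i] of [spread_prod_le] are positive and can be cancelled. At
    equality both terms on its left vanish: if [1 < A * C], the square gives [a1 = a2], and the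
    other term gives [a2 = 0] because [A * C * (a1 * a2) <= a2 < 1]. *)
Lemma spread_prod_le1 A C a1 b1 a2 b2 :
  1 <= A -> 1 <= C -> 0 <= a1 <= b1 -> 0 <= a2 <= b2 -> b1 <= 1 -> b2 <= 1 ->
  A * C * (a1 * b2) <= (1 - a1) * (1 - b2) ->
  A * C * (b1 * a2) <= (1 - b1) * (1 - a2) ->
  A * C * a1 <= b1 -> A * C * a2 <= b2 ->
  (b1 + A * a1) * (b2 + C * a2) <= 1 /\
  (1 < A * C -> (b1 + A * a1) * (b2 + C * a2) = 1 ->
   [/\ a1 = 0, a2 = 0, b1 = 1 & b2 = 1]).
Proof.
move=> hA hC a1P a2P b11 b21 h1 h2 s1 s2.
have := spread_prod_le hA hC a1P a2P b11 b21 h1 h2 s1 s2.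
have /andP[a10 ab1] := a1P; have /andP[a20 ab2] := a2P.
have g1 : 1 <= A * C by rewrite -[1]mulr1 ler_pM.
have D10 : 0 < 1 + (A * C - 1) * a1.
  by rewrite ltr_pwDl// mulr_ge0// subr_ge0.
have D20 : 0 < 1 + (A * C - 1) * a2.
  by rewrite ltr_pwDl// mulr_ge0// subr_ge0.
have a21 : a2 <= 1 by lra.
have gaa : A * C * (a1 * a2) <= a2 by rewrite mulrA ler_piMl// (le_trans s1).
have S1 : 0 <= A * C * (a1 - a2) ^+ 2 by rewrite mulr_ge0 ?sqr_ge0//; lra.
have S2 : 0 <= (A * C - 1) ^+ 2 * (a1 * a2) * (1 - A * C * (a1 * a2)).
  apply: mulr_ge0; first exact: mulr_ge0 (sqr_ge0 _) (mulr_ge0 a10 a20).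
  by rewrite subr_ge0 (le_trans gaa).
move=> main; split.
  rewrite -subr_ge0 -(pmulr_rge0 _ (mulr_gt0 D10 D20)).
  by rewrite (le_trans _ main)// addr_ge0.
move=> g2 E; move: main; rewrite E subrr mulr0 => main.
have a12 : a1 = a2.
  have /eqP : A * C * (a1 - a2) ^+ 2 = 0 by lra.
  rewrite mulf_eq0 gt_eqF/= ?(lt_trans _ g2)// sqrf_eq0 subr_eq0.
  by move/eqP.
have a2lt1 : a2 < 1.
  rewrite lt_def a21 andbT; apply/eqP => a2E.
  by move: s2; rewrite -a2E mulr1 leNgt (le_lt_trans b21).
have a2E : a2 = 0.
  have /eqP : (A * C - 1) ^+ 2 * (a1 * a2) * (1 - A * C * (a1 * a2)) = 0 by lra.
  have k0 : ((A * C - 1) ^+ 2 == 0) = false.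
    by rewrite sqrf_eq0 gt_eqF ?subr_gt0.
  rewrite a12 mulf_eq0 mulf_eq0 k0 mulf_eq0 orbb /=.
  rewrite subr_eq0 => /orP[/eqP//|/eqP E1].
  by move: a2lt1; rewrite ltNge (le_trans _ gaa)// a12 -E1.
move: E; rewrite a12 a2E !mulr0 !addr0 => E.
have b10 : 0 <= b1 by lra.
have b20 : 0 <= b2 by lra.
have b1b2 : b1 * b2 <= b1 by rewrite ler_piMr.
have b1E : b1 = 1 by lra.
by split=> //; move: E; rewrite b1E mul1r.
Qed.

(** The two equality cases feed the induction: either the sections are those of a star at the split
    coordinate, or both mixed pairs are extremal themselves. *)
Lemma odds_prod_le A C a1 b1 a2 b2 :
  1 <= A -> 1 <= C -> 0 <= a1 <= b1 -> 0 <= a2 <= b2 -> b1 <= 1 -> b2 <= 1 ->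
  A * C * (a1 * b2) <= (1 - a1) * (1 - b2) ->
  A * C * (b1 * a2) <= (1 - b1) * (1 - a2) ->
  (1 + A) * (1 + C) * (a1 * b2) <= 1 ->
  (1 + A) * (1 + C) * (b1 * a2) <= 1 ->
  (b1 + A * a1) * (b2 + C * a2) <= 1 /\
  (1 < A * C -> (b1 + A * a1) * (b2 + C * a2) = 1 ->
   [/\ a1 = 0, a2 = 0, b1 = 1 & b2 = 1] \/
   ((1 + A) * (1 + C) * (a1 * b2) = 1 /\ (1 + A) * (1 + C) * (b1 * a2) = 1)).
Proof.
move=> hA hC a1P a2P b11 b21 h1 h2 k1 k2.
have /andP[a10 ab1] := a1P; have /andP[a20 ab2] := a2P.
have g1 : 1 <= A * C by rewrite -[1]mulr1 ler_pM.
have g0 : 0 <= A * C by lra.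
have spread : A * C * a1 <= b1 -> A * C * a2 <= b2 ->
    (b1 + A * a1) * (b2 + C * a2) <= 1 /\
    (1 < A * C -> (b1 + A * a1) * (b2 + C * a2) = 1 ->
     [/\ a1 = 0, a2 = 0, b1 = 1 & b2 = 1] \/
     ((1 + A) * (1 + C) * (a1 * b2) = 1 /\
      (1 + A) * (1 + C) * (b1 * a2) = 1)).
  move=> s1 s2.
  have [le1 eq1] := spread_prod_le1 hA hC a1P a2P b11 b21 h1 h2 s1 s2.
  by split=> // g2 /(eq1 g2); left.
(* If [a1 * b2] is the larger cross product and [A C a1 < b1], then
   [b1 (A C a2) <= A C a1 b2 <= b1 b2], so [A C a2 <= b2] as well: one spread inequality yields the
   other. The second half exchanges the two families. *)
have [s12|/ltW s12] := leP (b1 * a2) (a1 * b2).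
  have [s1|s1] := leP b1 (A * C * a1).
    have [le1 eq1] := narrow_prod_le hA hC a1P a2P k1 s1 s12.
    by split=> // _ /eq1; right.
  apply: spread (ltW s1) _.
  have b10 : 0 < b1 by apply: le_lt_trans s1; rewrite mulr_ge0.
  rewrite -(ler_pM2l b10) (@le_trans _ _ (A * C * (a1 * b2)))//.
    by rewrite [leLHS]mulrCA ler_wpM2l.
  by rewrite [leLHS]mulrA ler_wpM2r ?(ltW s1)// (le_trans a20).
have [s2|s2] := leP b2 (A * C * a2).
  have := @narrow_prod_le C A a2 b2 a1 b1 hC hA a2P a1P.
  rewrite [(1 + C) * _]mulrC [C * A]mulrC [a2 * b1]mulrC [b2 * a1]mulrC.
  move=> /(_ k2 s2 s12); rewrite [_ * (b1 + _)]mulrC => -[le1 eq1].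
  by split=> // _ /eq1[]; right.
apply: spread (ltW s2).
have b20 : 0 < b2 by apply: le_lt_trans s2; rewrite mulr_ge0.
rewrite -(ler_pM2r b20) (@le_trans _ _ (A * C * (b1 * a2)))//.
  by rewrite -[leLHS]mulrA ler_wpM2l.
by rewrite [leLHS]mulrCA ler_wpM2l ?(ltW s2)// (le_trans a10).
Qed.

(* The second inequality says that the product of the odds of [x] and [y] is at
   most that of [c1] and [c2], without division by zero at [x = 1]. *)
Definition region c1 c2 x y : Prop :=
  x * y <= c1 * c2 /\
  x * y * ((1 - c1) * (1 - c2)) <= c1 * c2 * ((1 - x) * (1 - y)).

Lemma region_le c1 c2 x y x' y' : 0 < c1 < 1 -> 0 < c2 < 1 ->
  0 <= x' <= x -> 0 <= y' <= y -> x <= 1 -> y <= 1 ->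
  region c1 c2 x y -> region c1 c2 x' y'.
Proof.
move=> c1P c2P xP yP x1 y1 [h1 h2].
have P0 : 0 < c1 * c2 by rewrite mulr_gt0; lra.
have xy : x' * y' <= x * y by rewrite ler_pM; lra.
split; first exact: le_trans h1.
apply: (@le_trans _ _ (x * y * ((1 - c1) * (1 - c2)))).
  by rewrite ler_wpM2r// mulr_ge0; lra.
by apply: (le_trans h2); rewrite ler_wpM2l ?(ltW P0)// ler_pM; lra.
Qed.

(** The gap between the two sides is affine in each of the two mixed values. Expanding it at the
    four corners gives exactly the sum of the terms in [F2], [F3] and [F4]: the last two are the
    gaps at the mixed pairs, and the first collects what remains, with the factor [1 - c1 - c2],
    nonnegative since both caps are at most 1/2. *)
Lemma hoffman_step c1 c2 a1 b1 a2 b2 :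
  0 < c1 <= 1 / 2 -> 0 < c2 <= 1 / 2 ->
  0 <= a1 <= b1 -> 0 <= a2 <= b2 -> b1 <= 1 -> b2 <= 1 ->
  a1 * b2 * ((1 - c1) * (1 - c2)) <= c1 * c2 * ((1 - a1) * (1 - b2)) ->
  b1 * a2 * ((1 - c1) * (1 - c2)) <= c1 * c2 * ((1 - b1) * (1 - a2)) ->
  ((1 - c1) * a1 + c1 * b1) * ((1 - c2) * a2 + c2 * b2) *
    ((1 - c1) * (1 - c2)) <=
  c1 * c2 * ((1 - ((1 - c1) * a1 + c1 * b1)) *
             (1 - ((1 - c2) * a2 + c2 * b2))).
Proof.
move=> c1P c2P a1P a2P b11 b21 h1 h2.
have Q0 : 0 <= (1 - c1) * (1 - c2) by rewrite mulr_ge0; lra.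
have d0 : 0 <= 1 - c1 - c2 by lra.
have P0 : 0 <= c1 * c2 by rewrite mulr_ge0; lra.
have aa : a1 * a2 * ((1 - c1) * (1 - c2)) <= a1 * b2 * ((1 - c1) * (1 - c2)).
  by rewrite ler_wpM2r// ler_wpM2l; lra.
have F1 : 0 <= c1 * c2 * ((1 - b1) * (b2 - a2)).
  by rewrite mulr_ge0// mulr_ge0; lra.
(* By [aa] and the bound at [(a1, b2)], the second factor is at least the term of [F1]. *)
have F2 : 0 <= (1 - c1 - c2) *
    (c1 * c2 * ((1 - a1) * (1 - a2)) - c1 * c2 * ((b1 - a1) * (b2 - a2))
     - a1 * a2 * ((1 - c1) * (1 - c2))).
  rewrite mulr_ge0//; lra.
have F3 : 0 <= c2 *
    (c1 * c2 * ((1 - a1) * (1 - b2)) - a1 * b2 * ((1 - c1) * (1 - c2))).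
  by rewrite mulr_ge0; lra.
have F4 : 0 <= c1 *
    (c1 * c2 * ((1 - b1) * (1 - a2)) - b1 * a2 * ((1 - c1) * (1 - c2))).
  by rewrite mulr_ge0; lra.
lra.
Qed.

Lemma odds_ge1 c : 0 < c <= 1 / 2 -> 1 <= (1 - c) / c.
Proof. by move=> cP; rewrite ler_pdivlMr; lra. Qed.

Lemma region_odds c1 c2 x y : 0 < c1 <= 1 / 2 -> 0 < c2 <= 1 / 2 ->
  region c1 c2 x y ->
  (1 + (1 - c1) / c1) * (1 + (1 - c2) / c2) * (x * y) <= 1 /\
  (1 - c1) / c1 * ((1 - c2) / c2) * (x * y) <= (1 - x) * (1 - y).
Proof.
move=> c1P c2P [h1 h2].
have P0 : 0 < c1 * c2 by rewrite mulr_gt0; lra.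
have c10 : c1 != 0 by lra.
have c20 : c2 != 0 by lra.
split; rewrite -(ler_pM2l P0).
  rewrite mulr1; have -> // :
    c1 * c2 * ((1 + (1 - c1) / c1) * (1 + (1 - c2) / c2) * (x * y)) = x * y.
  by field; rewrite ?c10 ?c20.
have -> // : c1 * c2 * ((1 - c1) / c1 * ((1 - c2) / c2) * (x * y)) =
  x * y * ((1 - c1) * (1 - c2)).
by field; rewrite ?c10 ?c20.
Qed.

(** Factoring [c_i] out of each mixture leaves [b_i + a_i (1 - c_i) / c_i], which puts the product
    bound in the form of [odds_prod_le]. *)
Lemma region_step c1 c2 a1 b1 a2 b2 :
  0 < c1 <= 1 / 2 -> 0 < c2 <= 1 / 2 ->
  0 <= a1 <= b1 -> 0 <= a2 <= b2 -> b1 <= 1 -> b2 <= 1 ->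
  region c1 c2 a1 b2 -> region c1 c2 b1 a2 ->
  let x := (1 - c1) * a1 + c1 * b1 in let y := (1 - c2) * a2 + c2 * b2 in
  region c1 c2 x y /\
  (~ (c1 = 1 / 2 /\ c2 = 1 / 2) -> x * y = c1 * c2 ->
   [/\ a1 = 0, a2 = 0, b1 = 1 & b2 = 1] \/
   (a1 * b2 = c1 * c2 /\ b1 * a2 = c1 * c2)).
Proof.
move=> c1P c2P a1P a2P b11 b21 r1 r2 x y.
have [k1 h1] := region_odds c1P c2P r1.
have [k2 h2] := region_odds c1P c2P r2.
have [le1 eq1] := odds_prod_le (odds_ge1 c1P) (odds_ge1 c2P) a1P a2P b11 b21 h1
  h2 k1 k2.
have P0 : 0 < c1 * c2 by rewrite mulr_gt0; lra.
have c10 : c1 != 0 by lra.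
have c20 : c2 != 0 by lra.
have E : x * y = c1 * c2 * ((b1 + (1 - c1) / c1 * a1) * (b2 + (1 - c2) / c2 *
  a2)).
  by rewrite /x /y; field; rewrite ?c10 ?c20.
split.
  split; first by rewrite E ler_piMr// ltW.
  by case: r1 r2 => [_ r1] [_ r2]; apply: hoffman_step.
move=> nhalf; rewrite E => /(canRL (mulKf (lt0r_neq0 P0)));
  rewrite mulVf ?lt0r_neq0//.
(* Each odds is at least 1, and equals 1 only at 1/2. *)
have g1 : 1 < (1 - c1) / c1 * ((1 - c2) / c2).
  rewrite mulf_div ltr_pdivlMr// mul1r.
  have [c1h|/eqP c1h] := eqVneq c1 (1 / 2); last by lra.
  have [c2h|/eqP c2h] := eqVneq c2 (1 / 2); last by lra.
  by case: nhalf.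
move=> /(eq1 g1)[|[e1 e2]]; [by left|right].
have K z : (1 + (1 - c1) / c1) * (1 + (1 - c2) / c2) * z = 1 -> z = c1 * c2.
  by move=> e; rewrite -[RHS]mulr1 -e; field; rewrite ?c10 ?c20.
by split; apply: K.
Qed.

(** As [a_i <= b_i], lowering the weight from [c_i] to [r_i] lowers the mixture, so [region_le]
    reduces to [region_step]. At equality neither mixture has dropped; when [a_i = 0] and [b_i = 1]
    this says [r_i = c_i]. *)
Lemma region_mix c1 c2 r1 r2 a1 b1 a2 b2 :
  0 < c1 <= 1 / 2 -> 0 < c2 <= 1 / 2 -> 0 < r1 <= c1 -> 0 < r2 <= c2 ->
  0 <= a1 <= b1 -> 0 <= a2 <= b2 -> b1 <= 1 -> b2 <= 1 ->
  region c1 c2 a1 b2 -> region c1 c2 b1 a2 ->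
  let x := (1 - r1) * a1 + r1 * b1 in let y := (1 - r2) * a2 + r2 * b2 in
  region c1 c2 x y /\
  (~ (c1 = 1 / 2 /\ c2 = 1 / 2) -> x * y = c1 * c2 ->
   [/\ r1 = c1, r2 = c2 & [/\ a1 = 0, a2 = 0, b1 = 1 & b2 = 1]] \/
   (a1 * b2 = c1 * c2 /\ b1 * a2 = c1 * c2)).
Proof.
move=> c1P c2P r1P r2P a1P a2P b1P b2P r01 r10 x y.
have [] := region_step c1P c2P a1P a2P b1P b2P r01 r10.
have P0 : 0 < c1 * c2 by rewrite mulr_gt0; lra.
have x0 : 0 <= x by rewrite addr_ge0// mulr_ge0; lra.
have y0 : 0 <= y by rewrite addr_ge0// mulr_ge0; lra.
have t1 : 0 <= (c1 - r1) * (b1 - a1) by rewrite mulr_ge0; lra.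
have t2 : 0 <= (c2 - r2) * (b2 - a2) by rewrite mulr_ge0; lra.
have v1 : 0 <= (1 - c1) * (b1 - a1) by rewrite mulr_ge0; lra.
have v2 : 0 <= (1 - c2) * (b2 - a2) by rewrite mulr_ge0; lra.
have X1 : (1 - c1) * a1 + c1 * b1 <= 1 by lra.
have Y1 : (1 - c2) * a2 + c2 * b2 <= 1 by lra.
have xX : x <= (1 - c1) * a1 + c1 * b1 by rewrite /x; lra.
have yY : y <= (1 - c2) * a2 + c2 * b2 by rewrite /y; lra.
move=> rXY eXY; split.
  by apply: region_le rXY => //; rewrite ?x0 ?y0//; lra.
move=> nh xyE; case: rXY => XYle _.
have x_gt0 : 0 < x.
  rewrite lt_def x0 andbT; apply: contraTneq P0 => xz.
  by rewrite -xyE xz mul0r ltxx.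
have y_gt0 : 0 < y.
  rewrite lt_def y0 andbT; apply: contraTneq P0 => yz.
  by rewrite -xyE yz mulr0 ltxx.
have XE : x = (1 - c1) * a1 + c1 * b1.
  apply/le_anti; rewrite xX -(ler_pM2r y_gt0) xyE (le_trans _ XYle)//.
  by rewrite ler_wpM2l// (le_trans x0).
have YE : y = (1 - c2) * a2 + c2 * b2.
  by apply/le_anti; rewrite yY -(ler_pM2l x_gt0) xyE (le_trans _ XYle)// XE.
case: (eXY nh); first by rewrite -XE -YE.
  move=> [a1E a2E b1E b2E]; left; split=> //.
    by move: XE; rewrite /x a1E b1E; lra.
  by move: YE; rewrite /y a2E b2E; lra.
by right.
Qed.

(** * A last mixing with weights above the caps *)

Lemma dominant_eq A A' C C' a1 b1 a2 b2 :
  1 <= A -> 1 <= C -> 0 < A' -> A' < A -> 0 < C' <= C ->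
  0 <= a1 <= b1 -> 0 <= a2 <= b2 -> b1 <= 1 -> b2 <= 1 ->
  A * C * (b1 * a2) <= (1 - b1) * (1 - a2) ->
  (b1 + A * a1) * (b2 + C * a2) <= 1 ->
  (b1 + A' * a1) * (b2 + C' * a2) = 1 ->
  [/\ a1 = 0, a2 = 0, b1 = 1 & b2 = 1].
Proof.
move=> hA hC A'0 A'A /andP[C'0 C'C] /andP[a10 ab1] /andP[a20 ab2] b11 b21 h2 le1
  E.
have b10 : 0 <= b1 by lra.
have b20 : 0 <= b2 by lra.
have X'0 : 0 <= b1 + A' * a1 by rewrite addr_ge0 ?mulr_ge0// ltW.
have Y'0 : 0 <= b2 + C' * a2 by rewrite addr_ge0 ?mulr_ge0// ltW.
have Y'_gt0 : 0 < b2 + C' * a2.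
  rewrite lt_def Y'0 andbT; apply/eqP => Y0.
  by move/eqP: E; rewrite Y0 mulr0 eq_sym oner_eq0.
have YY : b2 + C' * a2 <= b2 + C * a2 by rewrite lerD2l ler_wpM2r.
(* If [a1] were positive, raising [A'] to [A] would push the product strictly above 1, against
   [le1]. *)
have a1E : a1 = 0.
  apply/eqP; apply: contraT => a1n.
  have a1_gt0 : 0 < a1 by rewrite lt_def a1n.
  have : (b1 + A' * a1) * (b2 + C' * a2) < 1.
    apply: lt_le_trans le1; apply: (@lt_le_trans _ _ ((b1 + A * a1) * (b2 + C' *
      a2))).
      by rewrite ltr_pM2r// ltrD2l ltr_pM2r.
    by rewrite ler_wpM2l// addr_ge0// mulr_ge0//; lra.
  by rewrite E ltxx.
(* Now [E] and the bound at [(b1, a2)] combine into [(1 - b1) a2 + b1 (1 - b2) <= 0], a sum of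
   nonnegative terms. *)
move: E; rewrite a1E mulr0 addr0 mulrDr => E.
have P0 : 0 <= b1 * a2 by rewrite mulr_ge0.
have t1 : C' * (b1 * a2) <= A * C * (b1 * a2).
  by rewrite ler_wpM2r// (le_trans C'C)// ler_peMl//; lra.
have t2 : 0 <= (1 - b1) * a2 by rewrite mulr_ge0//; lra.
have t3 : 0 <= b1 * (1 - b2) by rewrite mulr_ge0//; lra.
have e2 : (1 - b1) * a2 = 0 by lra.
have e3 : b1 * (1 - b2) = 0 by lra.
have e1 : C' * (b1 * a2) = 1 - b1 by lra.
move/eqP: e2; rewrite mulf_eq0 => /orP[|/eqP a2E]; last first.
  move: e1; rewrite a2E !mulr0 => e1; have b1E : b1 = 1 by lra.
  by split=> //; move: e3; rewrite b1E; lra.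
rewrite subr_eq0 eq_sym => /eqP b1E; split=> //; last by move: e3; rewrite b1E;
  lra.
move/eqP: e1; rewrite b1E subrr mul1r mulf_eq0 (gt_eqF C'0)/=.
by move/eqP.
Qed.

Lemma odds_le c q : 0 < c -> c <= q -> (1 - q) / q <= (1 - c) / c.
Proof.
move=> c0 cq; rewrite ler_pdivrMr ?(lt_le_trans c0)// mulrAC ler_pdivlMr//; lra.
Qed.

Lemma odds_lt c q : 0 < c -> c < q -> (1 - q) / q < (1 - c) / c.
Proof.
move=> c0 cq; rewrite ltr_pdivrMr ?(lt_trans c0)// mulrAC ltr_pdivlMr//; lra.
Qed.

(** After division by [q1 * q2], the product has the form bounded in [odds_prod_le], with the odds
    of [q_i] in place of the larger odds of [c_i]. One strict inequality between [c_i] and [q_i] is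
    enough for rigidity, the two families being exchangeable in [dominant_eq]. *)
Lemma region_dominant c1 c2 q1 q2 a1 b1 a2 b2 :
  0 < c1 <= 1 / 2 -> 0 < c2 <= 1 / 2 -> c1 <= q1 < 1 -> c2 <= q2 < 1 ->
  0 <= a1 <= b1 -> 0 <= a2 <= b2 -> b1 <= 1 -> b2 <= 1 ->
  region c1 c2 a1 b2 -> region c1 c2 b1 a2 ->
  let x := (1 - q1) * a1 + q1 * b1 in let y := (1 - q2) * a2 + q2 * b2 in
  x * y <= q1 * q2 /\
  (c1 < q1 \/ c2 < q2 -> x * y = q1 * q2 ->
   [/\ a1 = 0, a2 = 0, b1 = 1 & b2 = 1]).
Proof.
move=> c1P c2P q1P q2P a1P a2P b11 b21 r01 r10 x y.
have [k1 h1] := region_odds c1P c2P r01.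
have [k2 h2] := region_odds c1P c2P r10.
have [A1 C1] := (odds_ge1 c1P, odds_ge1 c2P).
have [le1 _] := odds_prod_le A1 C1 a1P a2P b11 b21 h1 h2 k1 k2.
have /andP[c10 _] := c1P; have /andP[c20 _] := c2P.
have /andP[cq1 q11] := q1P; have /andP[cq2 q21] := q2P.
have q10 : 0 < q1 by apply: lt_le_trans cq1.
have q20 : 0 < q2 by apply: lt_le_trans cq2.
have A'0 : 0 < (1 - q1) / q1 by rewrite divr_gt0// subr_gt0.
have C'0 : 0 < (1 - q2) / q2 by rewrite divr_gt0// subr_gt0.
have AA := odds_le c10 cq1; have CC := odds_le c20 cq2.
have P0 : 0 < q1 * q2 by rewrite mulr_gt0.
have E : x * y = q1 * q2 * ((b1 + (1 - q1) / q1 * a1) * (b2 + (1 - q2) / q2 *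
  a2)).
  by rewrite /x /y; field; rewrite !gt_eqF.
have /andP[a10 ab1] := a1P; have /andP[a20 ab2] := a2P.
have b10 : 0 <= b1 by apply: le_trans ab1.
have b20 : 0 <= b2 by apply: le_trans ab2.
split.
  rewrite E ler_piMr ?(ltW P0)// (le_trans _ le1)//.
  apply: ler_pM; rewrite ?lerD2l ?ler_wpM2r//.
    by rewrite addr_ge0// mulr_ge0// ltW.
  by rewrite addr_ge0// mulr_ge0// ltW.
move=> cq; rewrite E => /(canRL (mulKf (lt0r_neq0 P0))).
rewrite mulVf ?lt0r_neq0// => E1.
have [cl1|cl2] := cq.
  have C'P : 0 < (1 - q2) / q2 <= (1 - c2) / c2 by rewrite C'0.
  exact: (dominant_eq A1 C1 A'0 (odds_lt c10 cl1) C'P a1P a2P b11 b21 h2 le1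
    E1).
have A'P : 0 < (1 - q1) / q1 <= (1 - c1) / c1 by rewrite A'0.
rewrite mulrC in E1; rewrite mulrC in le1.
rewrite [_ / c1 * _]mulrC [a1 * b2]mulrC [(1 - a1) * _]mulrC in h1.
by have [] := dominant_eq C1 A1 C'0 (odds_lt c20 cl2) A'P a2P a1P b21 b11 h1 le1
  E1.
Qed.

End Numeric.

(** * Sections and product measures *)

Section Families.
Variable n : nat.
Implicit Types (l : 'I_n) (x y S : {set 'I_n}) (U V : {set {set 'I_n}}).

(** Sections stay families on all of ['I_n], insensitive to [l], so the same vector [p] measures
    them. The coordinates still in play are recorded by [supported], whose set [S] carries the
    inductions. *)
Definition sec0 l U := [set x : {set 'I_n} | x :\ l \in U].
Definition sec1 l U := [set x : {set 'I_n} | l |: x \in U].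

Definition upset U := forall x y, x \subset y -> x \in U -> y \in U.
Definition up_closure U := [set y : {set 'I_n} | [exists x in U, x \subset y]].
Definition supported S U := forall x, (x \in U) = (x :&: S \in U).

Lemma up_closure_upset U : upset (up_closure U).
Proof.
move=> x y xy; rewrite !inE => /exists_inP[z zU zx].
by apply/exists_inP; exists z => //; apply: subset_trans xy.
Qed.

Lemma sub_up_closure U : U \subset up_closure U.
Proof. by apply/subsetP => x xU; rewrite inE; apply/exists_inP; exists x. Qed.

Lemma cross_sym U V : cross_intersecting U V -> cross_intersecting V U.
Proof. by move=> h x y xV yU; rewrite setIC h. Qed.

Lemma cross_up_closure U V :
  cross_intersecting U V -> cross_intersecting (up_closure U) (up_closure V).
Proof.
move=> h x y; rewrite !inE => /exists_inP[x' x'U x'x] /exists_inP[y' y'V y'y].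
have /set0Pn[i] := h _ _ x'U y'V; rewrite inE => /andP[ix iy].
by apply/set0Pn; exists i; rewrite inE (subsetP x'x)//= (subsetP y'y).
Qed.

Lemma sec0_upset l U : upset U -> upset (sec0 l U).
Proof. by move=> uU x y xy; rewrite !inE; apply/uU/setSD. Qed.

Lemma sec1_upset l U : upset U -> upset (sec1 l U).
Proof. by move=> uU x y xy; rewrite !inE; apply/uU/setUS. Qed.

Lemma sec0_sub_sec1 l U : upset U -> sec0 l U \subset sec1 l U.
Proof.
move=> uU; apply/subsetP => x; rewrite !inE; apply: uU.
exact: subset_trans (subD1set x l) (subsetUr _ _).
Qed.

Lemma sec0_supported l S U : supported S U -> supported (S :\ l) (sec0 l U).
Proof.
move=> sU x; rewrite !inE sU [RHS]sU; congr (_ \in U).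
by apply/setP => i; rewrite !inE; case: (i == l); case: (i \in x);
  case: (i \in S).
Qed.

Lemma sec1_supported l S U : supported S U -> supported (S :\ l) (sec1 l U).
Proof.
move=> sU x; rewrite !inE sU [RHS]sU; congr (_ \in U).
by apply/setP => i; rewrite !inE; case: (i == l); case: (i \in x);
  case: (i \in S).
Qed.

(** A common element of [x :\ l] and [l |: y] differs from [l], hence lies in both [x] and [y]. Two
    upper sections would lack this property, as their witnesses may all be [l]. *)
Lemma cross_sec01 l U V :
  cross_intersecting U V -> cross_intersecting (sec0 l U) (sec1 l V).
Proof.
move=> h x y; rewrite !inE => xU yV.
have /set0Pn[i] := h _ _ xU yV; rewrite !inE => /andP[/andP[il ix]].
by rewrite (negPf il)/= => iy; apply/set0Pn; exists i; rewrite inE ix.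
Qed.

Lemma cross_sec10 l U V :
  cross_intersecting U V -> cross_intersecting (sec1 l U) (sec0 l V).
Proof. by move=> /cross_sym /(@cross_sec01 l) /cross_sym. Qed.

Lemma sec_eq l U V : sec0 l U = sec0 l V -> sec1 l U = sec1 l V -> U = V.
Proof.
move=> e0 e1; apply/setP => x; have [lx|lx] := boolP (l \in x).
  have := congr1 (fun W : {set {set 'I_n}} => x \in W) e1; rewrite !inE.
  by rewrite (setUidPr _) ?sub1set.
have := congr1 (fun W : {set {set 'I_n}} => x \in W) e0; rewrite !inE.
by rewrite (setDidPl _)// disjoint_sym disjoints1.
Qed.

Lemma sec0_star l : sec0 l (star l) = set0.
Proof. by apply/setP => x; rewrite !inE eqxx. Qed.

Lemma sec1_star l : sec1 l (star l) = setT.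
Proof. by apply/setP => x; rewrite !inE eqxx. Qed.

Lemma sec0_star_neq l m : m != l -> sec0 l (star m) = star m.
Proof. by move=> ml; apply/setP => x; rewrite !inE ml. Qed.

Lemma sec1_star_neq l m : m != l -> sec1 l (star m) = star m.
Proof. by move=> ml; apply/setP => x; rewrite !inE (negPf ml). Qed.

Lemma supported0 U : supported set0 U -> U = set0 \/ U = setT.
Proof.
move=> sU; have [U0|U0] := boolP (set0 \in U); [right|left].
  by apply/setP => x; rewrite sU setI0 U0 inE.
by apply/setP => x; rewrite sU setI0 (negPf U0) inE.
Qed.

Lemma cross_setT U : cross_intersecting setT U -> U = set0.
Proof.
move=> h; apply/setP => x; rewrite [RHS]inE; apply/negbTE/negP => xU.
by have := h set0 x (in_setT _) xU; rewrite set0I eqxx.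
Qed.

(** * The product measure *)

Variables (R : realType) (p : 'I_n -> R).
Hypothesis pP : prob_vector p.

Let wt x : R := (\prod_(i in x) p i) * (\prod_(i in ~: x) (1 - p i)).

Lemma wt_gt0 x : 0 < wt x.
Proof.
by rewrite mulr_gt0// prodr_gt0// => i _; have /andP[] := pP i;
  rewrite ?subr_gt0.
Qed.

(** Expanding the product of the factors [p i + (1 - p i)], all equal to 1, yields the weights of
    all subsets. *)
Lemma pmeasureT : pmeasure p setT = 1.
Proof.
rewrite /pmeasure.
transitivity (\prod_(i < n) (p i + (1 - p i))); last first.
  by rewrite big1// => i _; rewrite addrC subrK.
rewrite bigA_distr; apply: eq_big => x; first by rewrite inE.
move=> _; rewrite [RHS](bigID (mem x))/=; congr (_ * _).
  by apply: eq_bigr => i ->.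
apply: eq_big => i; first by rewrite inE.
by rewrite inE => /negPf ->.
Qed.

Lemma pmeasure0 : pmeasure p set0 = 0.
Proof. by rewrite /pmeasure big_set0. Qed.

Lemma pmeasure_ge0 U : 0 <= pmeasure p U.
Proof. by apply: sumr_ge0 => x _; exact/ltW/wt_gt0. Qed.

Lemma pmeasure_setD U V : U \subset V ->
  pmeasure p V = pmeasure p U + pmeasure p (V :\: U).
Proof. by move=> UV; rewrite /pmeasure (big_setID U)/= (setIidPr UV). Qed.

(** Every single set has positive weight, as no probability is 0 or 1. This is what turns equalities
    of measures into equalities of families. *)
Lemma pmeasure_eq0 U : pmeasure p U = 0 -> U = set0.
Proof.
move=> U0; apply/eqP; apply: contraTT isT => /set0Pn[x xU].
have : 0 < pmeasure p U; last by rewrite U0 ltxx.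
rewrite /pmeasure (bigD1 x)//= ltr_pwDl// ?wt_gt0//.
by apply: sumr_ge0 => y _; exact/ltW/wt_gt0.
Qed.

Lemma pmeasure_le U V : U \subset V -> pmeasure p U <= pmeasure p V.
Proof. by move=> /pmeasure_setD ->; rewrite lerDl pmeasure_ge0. Qed.

Lemma pmeasure_sub_eq U V : U \subset V -> pmeasure p U = pmeasure p V -> U = V.
Proof.
move=> UV; rewrite (pmeasure_setD UV) => /esym/eqP.
rewrite -subr_eq0 addrC addKr => /eqP/pmeasure_eq0/eqP.
by rewrite setD_eq0 => VU; apply/eqP; rewrite eqEsubset UV.
Qed.

Lemma pmeasure_le1 U : pmeasure p U <= 1.
Proof. by rewrite -pmeasureT pmeasure_le// subsetT. Qed.

Lemma pmeasure_eq1 U : pmeasure p U = 1 -> U = setT.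
Proof. by move=> U1; apply: pmeasure_sub_eq; rewrite ?subsetT// pmeasureT. Qed.

Lemma pmeasure_sec l U : pmeasure p U =
  (1 - p l) * pmeasure p (sec0 l U) + p l * pmeasure p (sec1 l U).
Proof.
(* The weight of [x] on the coordinates other than [l]; the sum is then grouped into pairs [x],
   [l |: x] with [l] outside [x]. *)
pose k x : R := (\prod_(i in x :\ l) p i) * (\prod_(i in ~: x :\ l) (1 - p i)).
have wt1 x : l \in x -> wt x = p l * k x.
  move=> lx; rewrite /wt /k (big_setD1 l lx)/= -mulrA.
  by congr (_ * (_ * _)); apply: eq_bigl => i; rewrite !inE;
    case: eqVneq => // ->; rewrite lx.
have wt0 x : l \notin x -> wt x = (1 - p l) * k x.
  move=> lx; rewrite /wt /k (big_setD1 l (A := ~: x)) ?inE//= mulrCA.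
  congr (_ * (_ * _)); apply: eq_bigl => i; rewrite !inE.
  by case: eqVneq => // ->; rewrite (negPf lx).
have kU x : k (l |: x) = k x.
  by rewrite /k; congr (_ * _); apply: eq_bigl => i; rewrite !inE; case: eqVneq.
have E V : pmeasure p V = \sum_(x : {set 'I_n} | l \notin x)
    k x * ((1 - p l) * (x \in V)%:R + p l * (l |: x \in V)%:R).
  rewrite /pmeasure big_mkcond (bigID (fun x => l \in x))/=.
  rewrite (reindex_onto (fun x => l |: x) (fun x => x :\ l)) /=; last first.
    by move=> x lx; rewrite setD1K.
  rewrite (eq_bigl (fun x => l \notin x)); last first.
    move=> x; rewrite !inE eqxx/=; apply/eqP/idP => [<-|lx];
      first by rewrite !inE eqxx.
    by rewrite setU1K.
  rewrite addrC -big_split; apply: eq_bigr => x lx /=.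
  rewrite -!/(wt _) wt0// wt1 ?inE ?eqxx// kU.
  by case: (x \in V); case: (l |: x \in V); rewrite ?mulr1 ?mulr0 ?addr0 ?add0r;
    ring.
rewrite !E !mulr_sumr -big_split/=; apply: eq_bigr => x lx.
rewrite !inE setU1K// setUA setUid.
have -> : x :\ l = x by apply/setDidPl; rewrite disjoint_sym disjoints1.
by ring.
Qed.

Lemma pmeasure_star l : pmeasure p (star l) = p l.
Proof.
by rewrite (pmeasure_sec l) sec0_star sec1_star pmeasure0 pmeasureT mulr0 add0r
  mulr1.
Qed.

End Families.

Arguments sec0_upset {n} l {U}.
Arguments sec1_upset {n} l {U}.
Arguments sec0_sub_sec1 {n} l {U}.
Arguments sec0_supported {n} l {S U}.
Arguments sec1_supported {n} l {S U}.
Arguments cross_sec01 {n} l {U V}.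
Arguments cross_sec10 {n} l {U V}.

(** * Families on coordinates of probability at most 1/2 *)

Section Capped.
Variables (R : realType) (n : nat) (p1 p2 : 'I_n -> R).
Hypotheses (p1P : prob_vector p1) (p2P : prob_vector p2).
Implicit Types (l m : 'I_n) (S : {set 'I_n}) (U V : {set {set 'I_n}}).

Lemma sub_star l m : star l \subset star m -> l = m.
Proof.
move=> /subsetP/(_ [set l]); rewrite !inE eqxx => /(_ isT)/eqP.
by move=> ->.
Qed.

Lemma sec_measure (p : 'I_n -> R) l U : prob_vector p -> upset U ->
  0 <= pmeasure p (sec0 l U) <= pmeasure p (sec1 l U) /\
  pmeasure p (sec1 l U) <= 1.
Proof.
by move=> pP uU; rewrite pmeasure_ge0// pmeasure_le1// pmeasure_le//
  sec0_sub_sec1.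
Qed.

Lemma eq_star_sec l m U : m != l ->
  sec0 l U = star m -> sec1 l U = star m -> U = star m.
Proof.
by move=> ml e0 e1; apply: (@sec_eq _ l); rewrite ?sec0_star_neq ?sec1_star_neq.
Qed.

Lemma eq_star_sec01 l U : sec0 l U = set0 -> sec1 l U = setT -> U = star l.
Proof.
by move=> e0 e1; apply: (@sec_eq _ l); rewrite ?sec0_star ?sec1_star.
Qed.

Lemma sec1_set0 l U : upset U -> sec1 l U = set0 -> U = set0.
Proof.
move=> uU e1; have := sec0_sub_sec1 l uU; rewrite e1 subset0 => /eqP e0.
by apply: (@sec_eq _ l); rewrite ?e0 ?e1; apply/setP => x; rewrite !inE.
Qed.

(** Induction on the size of [S], splitting at any of its elements. The caps stay fixed while [S]
    shrinks, so they are only required to bound the probabilities on [S]. *)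
Lemma capped_region c1 c2 S U1 U2 :
  0 < c1 <= 1 / 2 -> 0 < c2 <= 1 / 2 ->
  (forall l, l \in S -> p1 l <= c1) -> (forall l, l \in S -> p2 l <= c2) ->
  upset U1 -> upset U2 -> supported S U1 -> supported S U2 ->
  cross_intersecting U1 U2 ->
  region c1 c2 (pmeasure p1 U1) (pmeasure p2 U2) /\
  (~ (c1 = 1 / 2 /\ c2 = 1 / 2) ->
   pmeasure p1 U1 * pmeasure p2 U2 = c1 * c2 ->
   exists2 l, l \in S &
     [/\ p1 l = c1, p2 l = c2, U1 = star l & U2 = star l]).
Proof.
move=> c1P c2P.
have P0 : 0 < c1 * c2 by rewrite mulr_gt0; lra.
have [k] := ubnP #|S|; elim: k S U1 U2 => // k IH S U1 U2 Sk pc1 pc2 u1 u2 s1 s2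
  cross.
(* Without coordinates each family is empty or full, and cross-intersection leaves one of them
   empty. *)
have [S0|[l lS]] := set_0Vmem S.
  have xy0 : pmeasure p1 U1 = 0 \/ pmeasure p2 U2 = 0.
    move: s1 cross; rewrite S0 => /supported0[->|->]; first by left;
      rewrite pmeasure0.
    by move=> /cross_setT ->; right; rewrite pmeasure0.
  have x0 := pmeasure_ge0 p1P U1; have x1 := pmeasure_le1 p1P U1.
  have y0 := pmeasure_ge0 p2P U2; have y1 := pmeasure_le1 p2P U2.
  have xyE : pmeasure p1 U1 * pmeasure p2 U2 = 0.
    by case: xy0 => ->; rewrite ?mul0r ?mulr0.
  split; last by rewrite xyE => _ e; move: P0; rewrite -e ltxx.
  split; first by rewrite xyE ltW.
  by rewrite xyE mul0r mulr_ge0 ?(ltW P0)// mulr_ge0 ?subr_ge0.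
have Sk' : (#|S :\ l| < k)%N by rewrite (cardsD1 l) lS in Sk.
have pc1' m : m \in S :\ l -> p1 m <= c1 by rewrite inE => /andP[_ /pc1].
have pc2' m : m \in S :\ l -> p2 m <= c2 by rewrite inE => /andP[_ /pc2].
have [r01 e01] := IH _ _ _ Sk' pc1' pc2' (sec0_upset l u1) (sec1_upset l u2)
  (sec0_supported l s1) (sec1_supported l s2) (cross_sec01 l cross).
have [r10 e10] := IH _ _ _ Sk' pc1' pc2' (sec1_upset l u1) (sec0_upset l u2)
  (sec1_supported l s1) (sec0_supported l s2) (cross_sec10 l cross).
have [a1P b1P] := sec_measure l p1P u1; have [a2P b2P] := sec_measure l p2P u2.
have p1l : 0 < p1 l <= c1 by have /andP[-> _] := p1P l; rewrite pc1.
have p2l : 0 < p2 l <= c2 by have /andP[-> _] := p2P l; rewrite pc2.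
have := region_mix c1P c2P p1l p2l a1P a2P b1P b2P r01 r10.
rewrite -!pmeasure_sec => -[rxy eqxy]; split=> // nh /(eqxy nh).
case=> [[p1E p2E [a1E a2E b1E b2E]]|[E01 E10]].
  exists l => //; split=> //; apply: eq_star_sec01.
  - exact: (pmeasure_eq0 p1P a1E).
  - exact: (pmeasure_eq1 p1P b1E).
  - exact: (pmeasure_eq0 p2P a2E).
  - exact: (pmeasure_eq1 p2P b2E).
have [m mS [pm1 pm2 U1m U2m]] := e01 nh E01.
have [m' _ [_ _ U1m' U2m']] := e10 nh E10.
(* The two mixed pairs are stars, a priori at different centres; the inclusion of the lower section
   of [U1] in the upper one identifies them. *)
have mm' : m = m' by apply: sub_star; rewrite -U1m -U1m' sec0_sub_sec1.
move: mS; rewrite !inE => /andP[ml mS]; exists m => //.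
by split=> //; apply: (eq_star_sec ml) => //; rewrite mm'.
Qed.

(** * Equality when both caps are 1/2 *)

Definition half_set S := [set l in S | (p1 l == 1 / 2) && (p2 l == 1 / 2)].

Lemma cross_half_le1 S U1 U2 :
  (forall l, l \in S -> p1 l <= 1 / 2) -> (forall l, l \in S -> p2 l <= 1 / 2)
    ->
  upset U1 -> upset U2 -> supported S U1 -> supported S U2 ->
  cross_intersecting U1 U2 -> pmeasure p1 U1 + pmeasure p2 U2 <= 1.
Proof.
move=> pc1 pc2 u1 u2 s1 s2 cross.
have hP : 0 < (1 / 2 : R) <= 1 / 2 by rewrite lexx andbT divr_gt0.
have [[_ h] _] := capped_region hP hP pc1 pc2 u1 u2 s1 s2 cross; lra.
Qed.

(** The sum of the two measures is the average of the sums over the two mixed pairs, each at most 1,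
    minus the losses [(1/2 - p_i(l)) (b_i - a_i)]. A total of 1 makes both sums 1 and both losses 0,
    so off [half_set] the sections coincide. *)
Lemma cross_half_sec l S U1 U2 : l \in S ->
  (forall l, l \in S -> p1 l <= 1 / 2) -> (forall l, l \in S -> p2 l <= 1 / 2)
    ->
  upset U1 -> upset U2 -> supported S U1 -> supported S U2 ->
  cross_intersecting U1 U2 -> pmeasure p1 U1 + pmeasure p2 U2 = 1 ->
  [/\ pmeasure p1 (sec0 l U1) + pmeasure p2 (sec1 l U2) = 1,
      pmeasure p1 (sec1 l U1) + pmeasure p2 (sec0 l U2) = 1,
      pmeasure p1 U1 = (pmeasure p1 (sec0 l U1) + pmeasure p1 (sec1 l U1)) / 2,
      pmeasure p2 U2 = (pmeasure p2 (sec0 l U2) + pmeasure p2 (sec1 l U2)) / 2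
    & l \notin half_set S -> sec0 l U1 = sec1 l U1 /\ sec0 l U2 = sec1 l U2].
Proof.
move=> lS pc1 pc2 u1 u2 s1 s2 cross.
have pc1' m : m \in S :\ l -> p1 m <= 1 / 2 by rewrite inE => /andP[_ /pc1].
have pc2' m : m \in S :\ l -> p2 m <= 1 / 2 by rewrite inE => /andP[_ /pc2].
have h01 := cross_half_le1 pc1' pc2' (sec0_upset l u1) (sec1_upset l u2)
  (sec0_supported l s1) (sec1_supported l s2) (cross_sec01 l cross).
have h10 := cross_half_le1 pc1' pc2' (sec1_upset l u1) (sec0_upset l u2)
  (sec1_supported l s1) (sec0_supported l s2) (cross_sec10 l cross).
have [a1P b1P] := sec_measure l p1P u1; have [a2P b2P] := sec_measure l p2P u2.
have pl1 := pc1 _ lS; have pl2 := pc2 _ lS.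
rewrite (pmeasure_sec p1 l U1) (pmeasure_sec p2 l U2) => sum1.
have t1 : 0 <= (1 / 2 - p1 l) * (pmeasure p1 (sec1 l U1) - pmeasure p1 (sec0 l
  U1)).
  by rewrite mulr_ge0; lra.
have t2 : 0 <= (1 / 2 - p2 l) * (pmeasure p2 (sec1 l U2) - pmeasure p2 (sec0 l
  U2)).
  by rewrite mulr_ge0; lra.
have z1 : (1 / 2 - p1 l) * (pmeasure p1 (sec1 l U1) - pmeasure p1 (sec0 l U1)) =
  0 by lra.
have z2 : (1 / 2 - p2 l) * (pmeasure p2 (sec1 l U2) - pmeasure p2 (sec0 l U2)) =
  0 by lra.
have e01 : pmeasure p1 (sec0 l U1) + pmeasure p2 (sec1 l U2) = 1 by lra.
have e10 : pmeasure p1 (sec1 l U1) + pmeasure p2 (sec0 l U2) = 1 by lra.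
split=> //; [lra|lra|].
rewrite inE lS/= negb_and => nw.
have ab : pmeasure p1 (sec0 l U1) = pmeasure p1 (sec1 l U1) /\
          pmeasure p2 (sec0 l U2) = pmeasure p2 (sec1 l U2).
  case/orP: nw => [n1|n2].
    by move/eqP: z1; rewrite mulf_eq0 subr_eq0 eq_sym (negPf n1)/= => /eqP; lra.
  by move/eqP: z2; rewrite mulf_eq0 subr_eq0 eq_sym (negPf n2)/= => /eqP; lra.
case: ab => ab1 ab2.
split; first exact: (pmeasure_sub_eq p1P (sec0_sub_sec1 l u1) ab1).
exact: (pmeasure_sub_eq p2P (sec0_sub_sec1 l u2) ab2).
Qed.

Lemma card_half_setD1 S l : #|half_set (S :\ l)| = (#|half_set S| - (l \in
  half_set S))%N.
Proof.
have -> : half_set (S :\ l) = half_set S :\ l by apply/setP => m;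
  rewrite !inE -!andbA.
by rewrite (cardsD1 l (half_set S)) addKn.
Qed.

Lemma cross_half_sum_eq1 S U1 U2 : (#|half_set S| <= 1)%N ->
  (forall l, l \in S -> p1 l <= 1 / 2) -> (forall l, l \in S -> p2 l <= 1 / 2)
    ->
  upset U1 -> upset U2 -> supported S U1 -> supported S U2 ->
  cross_intersecting U1 U2 -> pmeasure p1 U1 + pmeasure p2 U2 = 1 ->
  [\/ U1 = set0, U2 = set0 |
      exists2 l, l \in half_set S & U1 = star l /\ U2 = star l].
Proof.
have [k] := ubnP #|S|; elim: k S U1 U2 => // k IH S U1 U2 Sk wS pc1 pc2 u1 u2 s1
  s2 cross sum1.
have [S0|[l lS]] := set_0Vmem S.
  move: s1 cross; rewrite S0 => /supported0[->|->]; first by constructor 1.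
  by move=> /cross_setT ->; constructor 2.
have Sk' : (#|S :\ l| < k)%N by rewrite (cardsD1 l) lS in Sk.
have pc1' m : m \in S :\ l -> p1 m <= 1 / 2 by rewrite inE => /andP[_ /pc1].
have pc2' m : m \in S :\ l -> p2 m <= 1 / 2 by rewrite inE => /andP[_ /pc2].
have wS' : (#|half_set (S :\ l)| <= 1)%N by rewrite card_half_setD1 (leq_trans
  (leq_subr _ _)).
have [e01 e10 _ _ nw] := cross_half_sec lS pc1 pc2 u1 u2 s1 s2 cross sum1.
have i01 := IH _ _ _ Sk' wS' pc1' pc2' (sec0_upset l u1) (sec1_upset l u2)
  (sec0_supported l s1) (sec1_supported l s2) (cross_sec01 l cross) e01.
have i10 := IH _ _ _ Sk' wS' pc1' pc2' (sec1_upset l u1) (sec0_upset l u2)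
  (sec1_supported l s1) (sec0_supported l s2) (cross_sec10 l cross) e10.
have [lw|/nw[E1 E2]] := boolP (l \in half_set S).
  have w0 : half_set (S :\ l) = set0.
    by apply/eqP; rewrite -cards_eq0 card_half_setD1 lw subn_eq0.
  case: i01 => [a10|b20|[m]]; last by rewrite w0 inE.
    case: i10 => [b10|a20|[m]]; last by rewrite w0 inE.
      by constructor 1; apply: (sec1_set0 u1 b10).
    constructor 3; exists l => //; move: e01 e10;
      rewrite a10 a20 !pmeasure0 add0r addr0.
    move=> /(pmeasure_eq1 p2P) b2T /(pmeasure_eq1 p1P) b1T.
    by split; apply: eq_star_sec01.
  by constructor 2; apply: (sec1_set0 u2 b20).
case: i01 => [a10|b20|[m mw [a1m b2m]]].
- by constructor 1; apply: (sec1_set0 u1 (l := l)); rewrite -E1.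
- by constructor 2; apply: (sec1_set0 u2 b20).
move: mw; rewrite !inE => /andP[/andP[ml mS] mh].
constructor 3; exists m; first by rewrite inE mS.
by split; apply: (eq_star_sec ml) => //; rewrite ?E2 -?E1.
Qed.

(** A split at a coordinate of [half_set] leaves at most one, which is the case of
    [cross_half_sum_eq1]. The bound 2 is sharp: on three coordinates of probability 1/2, the sets
    containing at least two of them form a family of measure 1/2 that cross-intersects itself. *)
Lemma cross_half_eq S U1 U2 : (#|half_set S| <= 2)%N ->
  (forall l, l \in S -> p1 l <= 1 / 2) -> (forall l, l \in S -> p2 l <= 1 / 2)
    ->
  upset U1 -> upset U2 -> supported S U1 -> supported S U2 ->
  cross_intersecting U1 U2 -> pmeasure p1 U1 = 1 / 2 -> pmeasure p2 U2 = 1 / 2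
    ->
  exists2 l, l \in half_set S & U1 = star l /\ U2 = star l.
Proof.
have [k] := ubnP #|S|; elim: k S U1 U2 => // k IH S U1 U2 Sk wS pc1 pc2 u1 u2 s1
  s2 cross h1 h2.
have sum1 : pmeasure p1 U1 + pmeasure p2 U2 = 1 by lra.
have [S0|[l lS]] := set_0Vmem S.
  move: s1 cross h1 h2; rewrite S0 => /supported0[->|->];
    first by rewrite pmeasure0; lra.
  by move=> /cross_setT ->; rewrite pmeasure0; lra.
have Sk' : (#|S :\ l| < k)%N by rewrite (cardsD1 l) lS in Sk.
have pc1' m : m \in S :\ l -> p1 m <= 1 / 2 by rewrite inE => /andP[_ /pc1].
have pc2' m : m \in S :\ l -> p2 m <= 1 / 2 by rewrite inE => /andP[_ /pc2].
have [e01 e10 m1 m2 nw] := cross_half_sec lS pc1 pc2 u1 u2 s1 s2 cross sum1.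
have [lw|/nw[E1 E2]] := boolP (l \in half_set S); last first.
  have wS' : (#|half_set (S :\ l)| <= 2)%N by rewrite card_half_setD1 (leq_trans
    (leq_subr _ _)).
  have a1h : pmeasure p1 (sec0 l U1) = 1 / 2 by move: m1; rewrite -E1; lra.
  have b2h : pmeasure p2 (sec1 l U2) = 1 / 2 by lra.
  have [m] := IH _ _ _ Sk' wS' pc1' pc2' (sec0_upset l u1) (sec1_upset l u2)
    (sec0_supported l s1) (sec1_supported l s2) (cross_sec01 l cross) a1h b2h.
  rewrite !inE => /andP[/andP[ml mS] mh] [a1m b2m].
  exists m; first by rewrite inE mS.
  by split; apply: (eq_star_sec ml) => //; rewrite ?E2 -?E1.
have wS' : (#|half_set (S :\ l)| <= 1)%N by rewrite card_half_setD1 lw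
  leq_subLR.
have i01 := cross_half_sum_eq1 wS' pc1' pc2' (sec0_upset l u1) (sec1_upset l u2)
  (sec0_supported l s1) (sec1_supported l s2) (cross_sec01 l cross) e01.
have i10 := cross_half_sum_eq1 wS' pc1' pc2' (sec1_upset l u1) (sec0_upset l u2)
  (sec1_supported l s1) (sec0_supported l s2) (cross_sec10 l cross) e10.
have U10 : U1 <> set0 by move=> U0; move: h1; rewrite U0 pmeasure0; lra.
have U20 : U2 <> set0 by move=> U0; move: h2; rewrite U0 pmeasure0; lra.
have starl : sec0 l U1 = set0 -> sec0 l U2 = set0 ->
    exists2 l, l \in half_set S & U1 = star l /\ U2 = star l.
  move=> a10 a20; exists l => //; move: e01 e10;
    rewrite a10 a20 !pmeasure0 add0r addr0.
  move=> /(pmeasure_eq1 p2P) b2T /(pmeasure_eq1 p1P) b1T.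
  by split; apply: eq_star_sec01.
(* An empty lower section of one family forces, by measure 1/2, a full upper section, and then [e10]
   or [e01] empties the lower section of the other: a star at [l]. *)
case: i01 => [a10|/(sec1_set0 u2)//|[m mw [a1m b2m]]].
  apply: starl => //; apply: (pmeasure_eq0 p2P).
  by move: m1; rewrite h1 a10 pmeasure0; lra.
case: i10 => [/(sec1_set0 u1)//|a20|[m' _ [b1m' a2m']]].
  apply: starl => //; apply: (pmeasure_eq0 p1P).
  by move: m2; rewrite h2 a20 pmeasure0; lra.
have mm' : m = m' by apply: sub_star; rewrite -a1m -b1m' sec0_sub_sec1.
move: mw; rewrite !inE => /andP[/andP[ml mS] mh].
exists m; first by rewrite inE mS.
by split; apply: (eq_star_sec ml) => //; rewrite mm'.
Qed.

End Capped.

(** * The theorem *)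

Lemma cross_upset_bound (R : realType) n (l0 : 'I_n) (p1 p2 : 'I_n -> R)
  (U1 U2 : {set {set 'I_n}}) :
  prob_vector p1 -> prob_vector p2 ->
  (forall l, p1 l <= p1 l0) -> (forall l, p2 l <= p2 l0) ->
  (forall l, l != l0 -> p1 l <= 1 / 2) ->
  (forall l, l != l0 -> p2 l <= 1 / 2) ->
  upset U1 -> upset U2 -> cross_intersecting U1 U2 ->
  let w := [set l | (p1 l == p1 l0) && (p2 l == p2 l0)] in
  pmeasure p1 U1 * pmeasure p2 U2 <= p1 l0 * p2 l0 /\
  (~ (p1 l0 = 1 / 2 /\ p2 l0 = 1 / 2 /\ (3 <= #|w|)%N) ->
   pmeasure p1 U1 * pmeasure p2 U2 = p1 l0 * p2 l0 ->
   exists2 l, l \in w & U1 = star l /\ U2 = star l).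
Proof.
move=> p1P p2P max1 max2 half1 half2 u1 u2 cross w.
have sT U : supported [set: 'I_n] U by move=> x; rewrite setIT.
have [/andP[q1h q2h]|big] := boolP ((p1 l0 <= 1 / 2) && (p2 l0 <= 1 / 2)).
  have c1P : 0 < p1 l0 <= 1 / 2 by have /andP[-> _] := p1P l0.
  have c2P : 0 < p2 l0 <= 1 / 2 by have /andP[-> _] := p2P l0.
  have m1 l : l \in [set: 'I_n] -> p1 l <= p1 l0 by [].
  have m2 l : l \in [set: 'I_n] -> p2 l <= p2 l0 by [].
  have [[le1 _] eq1] := capped_region p1P p2P c1P c2P m1 m2 u1 u2 (sT _) (sT _)
    cross.
  split=> // nw E.
  have [/andP[/eqP q1E /eqP q2E]|nh] := boolP ((p1 l0 == 1 / 2) && (p2 l0 == 1 /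
    2)); last first.
    case: eq1 => // [[/eqP e1 /eqP e2]|l _ [l1 l2 E1 E2]];
      first by rewrite e1 e2 in nh.
    by exists l => //; rewrite inE l1 l2 !eqxx.
  have h1 l : l \in [set: 'I_n] -> p1 l <= 1 / 2 by rewrite -q1E.
  have h2 l : l \in [set: 'I_n] -> p2 l <= 1 / 2 by rewrite -q2E.
  have sum1 := cross_half_le1 p1P p2P h1 h2 u1 u2 (sT _) (sT _) cross.
  (* With sum at most 1 and product 1/4, the squared difference is at most [1 - 4 / 4]. *)
  have sq : (pmeasure p1 U1 - pmeasure p2 U2) ^+ 2 <= 0.
    have s0 : 0 <= pmeasure p1 U1 + pmeasure p2 U2
      by rewrite addr_ge0 ?pmeasure_ge0.
    have : (pmeasure p1 U1 + pmeasure p2 U2) ^+ 2 <= 1 by rewrite expr_le1.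
    by move: E; rewrite q1E q2E; lra.
  have e12 : pmeasure p1 U1 = pmeasure p2 U2.
    by apply/eqP; rewrite -subr_eq0 -sqrf_eq0 eq_le sq sqr_ge0.
  have e1 : pmeasure p1 U1 = 1 / 2.
    have : (pmeasure p1 U1) ^+ 2 = (1 / 2) ^+ 2
      by rewrite !expr2 {2}e12 E q1E q2E.
    by move/eqP; rewrite eqrXn2 ?pmeasure_ge0 ?divr_ge0// => /eqP.
  have wE : half_set p1 p2 setT = w.
    by apply/setP => l; rewrite !inE q1E q2E.
  have w2 : (#|w| <= 2)%N by rewrite leqNgt; apply/negP => w3; apply: nw.
  rewrite -wE in w2 *.
  by apply: (cross_half_eq p1P p2P w2 h1 h2) => //; rewrite -e12.
(* One top probability exceeds 1/2. Off [l0] both bounds hold, whence the minimum as cap; in this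
   case [w] is [l0] alone. *)
pose c1 := Num.min (p1 l0) (1 / 2); pose c2 := Num.min (p2 l0) (1 / 2).
have minP (p : R) : 0 < p < 1 -> 0 < Num.min p (1 / 2) <= 1 / 2.
  by move=> /andP[p0 _]; rewrite lt_min p0 ge_min lexx orbT andbT; lra.
have c1P : 0 < c1 <= 1 / 2 := minP _ (p1P l0).
have c2P : 0 < c2 <= 1 / 2 := minP _ (p2P l0).
have q1P : c1 <= p1 l0 < 1 by rewrite ge_min lexx; have /andP[_ ->] := p1P l0.
have q2P : c2 <= p2 l0 < 1 by rewrite ge_min lexx; have /andP[_ ->] := p2P l0.
have m1 l : l \in [set: 'I_n] :\ l0 -> p1 l <= c1.
  by rewrite !inE andbT le_min max1 => /half1.
have m2 l : l \in [set: 'I_n] :\ l0 -> p2 l <= c2.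
  by rewrite !inE andbT le_min max2 => /half2.
have [r01 _] := capped_region p1P p2P c1P c2P m1 m2 (sec0_upset l0 u1)
  (sec1_upset l0 u2) (sec0_supported l0 (sT _)) (sec1_supported l0 (sT _))
    (cross_sec01 l0 cross).
have [r10 _] := capped_region p1P p2P c1P c2P m1 m2 (sec1_upset l0 u1)
  (sec0_upset l0 u2) (sec1_supported l0 (sT _)) (sec0_supported l0 (sT _))
    (cross_sec10 l0 cross).
have [a1P b1P] := sec_measure l0 p1P u1; have [a2P b2P] := sec_measure l0 p2P
  u2.
have [] := region_dominant c1P c2P q1P q2P a1P a2P b1P b2P r01 r10.
rewrite -!pmeasure_sec => le1 eq1; split=> // _ E.
have cq : c1 < p1 l0 \/ c2 < p2 l0.
  move: big; rewrite negb_and -!ltNge => /orP[b|b]; [left|right].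
    by rewrite gt_min b orbT.
  by rewrite gt_min b orbT.
have [a1E a2E b1E b2E] := eq1 cq E.
exists l0; first by rewrite inE !eqxx.
split; apply: eq_star_sec01.
- exact: (pmeasure_eq0 p1P a1E).
- exact: (pmeasure_eq1 p1P b1E).
- exact: (pmeasure_eq0 p2P a2E).
- exact: (pmeasure_eq1 p2P b2E).
Qed.

Theorem theorem2 (R : realType) (n : nat) (hn : (0 < n)%N)
  (p1 p2 : 'I_n -> R) (U1 U2 : {set {set 'I_n}}) :
  let l0 := Ordinal hn in
  prob_vector p1 -> prob_vector p2 ->
  (forall l, p1 l <= p1 l0) -> (forall l, p2 l <= p2 l0) ->
  (forall l, l != l0 -> p1 l <= 1 / 2) ->
  (forall l, l != l0 -> p2 l <= 1 / 2) ->
  cross_intersecting U1 U2 ->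
  let w := [set l | (p1 l == p1 l0) && (p2 l == p2 l0)] in
  pmeasure p1 U1 * pmeasure p2 U2 <= p1 l0 * p2 l0 /\
  (~ (p1 l0 = 1 / 2 /\ p2 l0 = 1 / 2 /\ (3 <= #|w|)%N) ->
   (pmeasure p1 U1 * pmeasure p2 U2 = p1 l0 * p2 l0 <->
    exists2 l, l \in w & U1 = star l /\ U2 = star l)).
Proof.
move=> l0 p1P p2P max1 max2 half1 half2 cross w.
have [] := cross_upset_bound p1P p2P max1 max2 half1 half2
  (@up_closure_upset _ U1) (@up_closure_upset _ U2) (cross_up_closure cross).
have le1 := pmeasure_le p1P (sub_up_closure U1).
have le2 := pmeasure_le p2P (sub_up_closure U2).
have x0 := pmeasure_ge0 p1P U1; have y0 := pmeasure_ge0 p2P U2.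
rewrite -/w => leV eqV.
have leU := ler_pM x0 y0 le1 le2.
split; first exact: le_trans leU leV.
move=> nw; split=> [E|[l]]; last first.
  by rewrite inE => /andP[/eqP <- /eqP <-] [-> ->]; rewrite !pmeasure_star.
have P0 : 0 < p1 l0 * p2 l0.
  by have [/andP[? _] /andP[? _]] := (p1P l0, p2P l0); rewrite mulr_gt0.
have x_gt0 : 0 < pmeasure p1 U1.
  rewrite lt_def x0 andbT; apply: contraTneq P0 => xz.
  by rewrite -E xz mul0r ltxx.
have y_gt0 : 0 < pmeasure p2 U2.
  rewrite lt_def y0 andbT; apply: contraTneq P0 => yz.
  by rewrite -E yz mulr0 ltxx.
(* Equality for [U1], [U2] and the bound for their up-closures leave no room for an increase of
   measure, both factors being positive. *)
have E1 : U1 = up_closure U1.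
  apply: (pmeasure_sub_eq p1P (sub_up_closure U1)); apply/le_anti.
  rewrite le1 -(ler_pM2r y_gt0) E (le_trans _ leV)//.
  by rewrite ler_wpM2l// pmeasure_ge0.
have E2 : U2 = up_closure U2.
  apply: (pmeasure_sub_eq p2P (sub_up_closure U2)); apply/le_anti.
  by rewrite le2 -(ler_pM2l x_gt0) E {1}E1 leV.
by rewrite E1 E2; apply: eqV => //; rewrite -E1 -E2.
Qed.
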